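(* Let $A$ be a finitely generated left-orderable group and $C$ a subgroup of $A$ such that $A$ is Hucha with respect to $C$ and $C$ is Prieto. Then: (i) for every injective homomorphism $\varphi:C\to A$, the HNN extension $A*_C t=\langle A,t \mid tct^{-1}=\varphi(c),\ c\in C\rangle$, if left-orderable, is Hucha; (ii) for every finitely generated group $B$ containing a copy of $C$, the amalgamated free product $A*_C B$, if left-orderable, is Hucha.
   Context: A positive cone of a group $G$ is a subsemigroup $P\subseteq G$ with $G=P\sqcup P^{-1}\sqcup\{1\}$; $G$ is left-orderable if it has one. For a finitely generated group $G$ with finite symmetric generating set $X$, $d_X$ is the word metric. An $r$-path is a finite sequence $g_0,\dots,g_n$ with $d_X(g_i,g_{i+1})\le r$. A subset $S$ coarsely connected if for some $r$ any two of its points are joined by an $r$-path inside $S$. A set $S$ $r$-disconnects subsets $H_1,H_2$ if every $r$-path starting in $H_1$ and ending in $H_2$ contains an element of $S$; $S$ $r$-disconnects $P$ if there are $u,v\in P$ such that $S$ $r$-disconnects $\{u\}$ and $\{v\}$. For a positive cone $P$ and subgroup $H$, a negative swamp of width $r$ for $H$ is a set $S\subseteq P^{-1}$ that $r$-disconnects $P$ and $r$-disconnects $g_1H$ and $g_2H$ for some $g_1,g_2\in G$. A finitely generated left-orderable group $G$ is Hucha with respect to a family $\mathcal{H}$ of subgroups if, for some finite generating set $X$ (the property is independent of $X$), for every positive cone $P$, every $H\in\mathcal{H}$ and every $r>0$ there is a negative swamp of width $r$ for $H$ in $\Gamma(G,X)$; Hucha with respect to $H$ means with respect to $\{H\}$,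 and Hucha means Hucha with respect to the trivial subgroup. A finitely generated left-orderable group is Prieto if all its positive cones are coarsely connected (with respect to a word metric from a finite generating set). *)

(* Defs.v *)
From Stdlib Require Import List Arith.
Import ListNotations.

Record Grp := {
  gcar :> Type;
  gmul : gcar -> gcar -> gcar;
  ginv : gcar -> gcar;
  gone : gcar;
  gmul_assoc : forall x y z, gmul x (gmul y z) = gmul (gmul x y) z;
  gmul_1l : forall x, gmul gone x = x;
  gmul_Vl : forall x, gmul (ginv x) x = gone
}.

Arguments gmul {g}.
Arguments ginv {g}.
Arguments gone {g}.

Definition is_hom {G K : Grp} (f : G -> K) : Prop :=
  forall x y, f (gmul x y) = gmul (f x) (f y).

Definition injective {X Y : Type} (f : X -> Y) : Prop :=
  forall x y, f x = f y -> x = y.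

Definition positive_cone (G : Grp) (P : G -> Prop) : Prop :=
  (forall x y, P x -> P y -> P (gmul x y)) /\
  (forall g, P g \/ P (ginv g) \/ g = gone) /\
  (forall g, ~ (P g /\ P (ginv g))) /\
  ~ P gone /\ ~ P (ginv gone).

Definition left_orderable (G : Grp) : Prop := exists P, positive_cone G P.

Definition letter {G : Grp} (X : list G) (x : G) : Prop := In x X \/ In (ginv x) X.

Definition wprod {G : Grp} (w : list G) : G := fold_right gmul gone w.

Definition generates {G : Grp} (X : list G) : Prop :=
  forall g, exists w, Forall (letter X) w /\ wprod w = g.

Definition fin_gen (G : Grp) : Prop := exists X : list G, generates X.

(* d_X(g,h) <= r, where d_X(g,h) = |g^{-1} h|_X (left-invariant word metric). *)
Definition dist_le {G : Grp} (X : list G) (g h : G) (r : nat) : Prop :=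
  exists w, length w <= r /\ Forall (letter X) w /\ gmul g (wprod w) = h.

Fixpoint chain {T : Type} (R : T -> T -> Prop) (x : T) (l : list T) : Prop :=
  match l with
  | [] => True
  | y :: l' => R x y /\ chain R y l'
  end.

Definition rpath {G : Grp} (X : list G) (r : nat) (x : G) (l : list G) : Prop :=
  chain (fun a b => dist_le X a b r) x l.

Definition coarsely_connected {G : Grp} (X : list G) (S : G -> Prop) : Prop :=
  exists r, forall u v, S u -> S v ->
    exists l, rpath X r u l /\ last l u = v /\ Forall S l.

Definition r_disconnects {G : Grp} (X : list G) (r : nat)
    (S H1 H2 : G -> Prop) : Prop :=
  forall x l, H1 x -> H2 (last l x) -> rpath X r x l ->
    exists y, (y = x \/ In y l) /\ S y.

Definition r_disconnects_set {G : Grp} (X : list G) (r : nat) (S P : G -> Prop) : Prop :=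
  exists u v, P u /\ P v /\ r_disconnects X r S (fun g => g = u) (fun g => g = v).

Definition lcoset {G : Grp} (g : G) (H : G -> Prop) : G -> Prop :=
  fun x => exists h, H h /\ x = gmul g h.

Definition negative_swamp {G : Grp} (X : list G) (P H : G -> Prop) (r : nat)
    (S : G -> Prop) : Prop :=
  (forall g, S g -> P (ginv g)) /\
  r_disconnects_set X r S P /\
  exists g1 g2, r_disconnects X r S (lcoset g1 H) (lcoset g2 H).

Definition Hucha_wrt (G : Grp) (F : (G -> Prop) -> Prop) : Prop :=
  left_orderable G /\
  exists X : list G, generates X /\
    forall P, positive_cone G P -> forall H, F H -> forall r, 0 < r ->
      exists S, negative_swamp X P H r S.

Definition Hucha (G : Grp) : Prop :=
  Hucha_wrt G (fun H => forall g, H g <-> g = gone).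

Definition Prieto (G : Grp) : Prop :=
  left_orderable G /\
  exists X : list G, generates X /\
    forall P, positive_cone G P -> coarsely_connected X P.

Definition image_sub {C A : Grp} (i : C -> A) : (A -> Prop) -> Prop :=
  fun H => forall g, H g <-> exists c, i c = g.

Definition is_HNN (A C : Grp) (i phi : C -> A) (G : Grp) (j : A -> G) (t : G) : Prop :=
  is_hom j /\
  (forall c, gmul (gmul t (j (i c))) (ginv t) = j (phi c)) /\
  forall (K : Grp) (f : A -> K) (s : K), is_hom f ->
    (forall c, gmul (gmul s (f (i c))) (ginv s) = f (phi c)) ->
    exists h : G -> K, (is_hom h /\ (forall a, h (j a) = f a) /\ h t = s) /\
      forall h' : G -> K, is_hom h' -> (forall a, h' (j a) = f a) -> h' t = s ->
        forall g, h' g = h g.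

Definition is_amalgam (A B C : Grp) (iA : C -> A) (iB : C -> B)
    (G : Grp) (jA : A -> G) (jB : B -> G) : Prop :=
  is_hom jA /\ is_hom jB /\
  (forall c, jA (iA c) = jB (iB c)) /\
  forall (K : Grp) (fA : A -> K) (fB : B -> K), is_hom fA -> is_hom fB ->
    (forall c, fA (iA c) = fB (iB c)) ->
    exists h : G -> K, (is_hom h /\ (forall a, h (jA a) = fA a) /\
                                    (forall b, h (jB b) = fB b)) /\
      forall h' : G -> K, is_hom h' -> (forall a, h' (jA a) = fA a) ->
        (forall b, h' (jB b) = fB b) -> forall g, h' g = h g.

(* Main.v *)
(** Fix a positive cone P of G and r > 0, and let f dominate the ball of radius r. All points
    crossed by an r-path of nonnegative elements satisfy x f >= 1, so those in the coset f^-1 A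
    have the form f^-1 a with a nonnegative for the cone Q = f P f^-1. Let g1 C and g2 C be
    cosets separated by a wide negative swamp of A for Q, and choose positive endpoints of the
    path in the branches of the Bass-Serre tree that hang from f^-1 A at these two cosets.
    Between them the path crosses f^-1 A. Each excursion away from it leaves and returns
    through one coset of an edge group; since C is Prieto for the cone induced by Q, the
    nonnegative part of such a coset is coarsely connected with a uniform constant, and
    the excursion can be replaced by a path inside it. This produces a path from g1 C to g2 C
    in A avoiding the swamp, a contradiction.

    Branches contain elements above any given one as soon as phi(C) <> A, resp. C <> B. The
    first always holds, for otherwise A would be both Prieto and Hucha; if C = B then G = A.
    The tree structure is read off an action on reduced words, to which the universal property
    gives access. *)

Require Import Defs.
From Stdlib Require Import List Arith Lia Relations.
From Stdlib Require Import Classical ClassicalEpsilon FunctionalExtensionality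
  PropExtensionality ProofIrrelevance.
Import ListNotations.

(* Group notation, cancellation and homomorphisms *)
Declare Scope grp_scope.
Local Open Scope grp_scope.
Local Infix "*" := gmul : grp_scope.
Local Notation "1" := gone : grp_scope.
Local Notation "x ^-1" := (ginv x) (at level 3, left associativity, format "x ^-1") : grp_scope.

Lemma gmul_Vr (G : Grp) (x : G) : x * x^-1 = 1.
Proof.
  rewrite <- (gmul_1l _ (x * x^-1)), <- (gmul_Vl _ (x^-1)) at 1.
  rewrite <- gmul_assoc, (gmul_assoc _ (x^-1) x), gmul_Vl, gmul_1l.
  apply gmul_Vl.
Qed.

Lemma gmul_1r (G : Grp) (x : G) : x * 1 = x.
Proof. now rewrite <- (gmul_Vl _ x), gmul_assoc, gmul_Vr, gmul_1l. Qed.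

Lemma gmulKV (G : Grp) (x y : G) : x^-1 * (x * y) = y.
Proof. now rewrite gmul_assoc, gmul_Vl, gmul_1l. Qed.

Lemma gmulVK (G : Grp) (x y : G) : x * (x^-1 * y) = y.
Proof. now rewrite gmul_assoc, gmul_Vr, gmul_1l. Qed.

Lemma gmul_cancel (G : Grp) (x y z : G) : x * y = x * z -> y = z.
Proof. intros H; now rewrite <- (gmulKV _ x y), H, gmulKV. Qed.

Lemma ginv_unique (G : Grp) (x y : G) : x * y = 1 -> x^-1 = y.
Proof. intros H; apply (gmul_cancel _ x); now rewrite H, gmul_Vr. Qed.

Lemma ginv_inv (G : Grp) (x : G) : (x^-1)^-1 = x.
Proof. apply ginv_unique, gmul_Vl. Qed.

Lemma ginv_mul (G : Grp) (x y : G) : (x * y)^-1 = y^-1 * x^-1.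
Proof.
  apply ginv_unique.
  now rewrite <- gmul_assoc, (gmul_assoc _ y), gmul_Vr, gmul_1l, gmul_Vr.
Qed.

Lemma ginv_one (G : Grp) : (1 : G)^-1 = 1.
Proof. apply ginv_unique, gmul_1l. Qed.

Local Hint Rewrite <- gmul_assoc : grp.
Local Hint Rewrite gmul_1l gmul_1r gmul_Vl gmul_Vr gmulKV gmulVK
  ginv_inv ginv_mul ginv_one : grp.

Ltac grp := autorewrite with grp; auto.

Lemma hom_one (G K : Grp) (f : G -> K) : is_hom f -> f 1 = 1.
Proof.
  intros Hf; apply (gmul_cancel _ (f 1)).
  now rewrite <- Hf, !gmul_1r.
Qed.

Lemma hom_inv (G K : Grp) (f : G -> K) (x : G) : is_hom f -> f (x^-1) = (f x)^-1.
Proof.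
  intros Hf; symmetry; apply ginv_unique.
  now rewrite <- Hf, gmul_Vr, hom_one.
Qed.

Lemma hom_conj (G : Grp) (f : G) : is_hom (fun g => f^-1 * g * f).
Proof. intros x y; grp. Qed.

Lemma conj_injective (G : Grp) (f : G) : injective (fun g => f^-1 * g * f).
Proof.
  intros x y H; cbn in H.
  apply (f_equal (fun z => f * z * f^-1)) in H; revert H; grp.
Qed.

Lemma image_mul_l (A C : Grp) (f : C -> A) (c : C) (a : A) : is_hom f ->
  (exists c', f c * a = f c') -> exists c', a = f c'.
Proof.
  intros Hf [c' H]; exists (c^-1 * c').
  rewrite Hf, hom_inv, <- H by assumption; grp.
Qed.

Lemma image_inv (A C : Grp) (f : C -> A) (a : A) : is_hom f ->
  (exists c, a^-1 = f c) -> exists c, a = f c.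
Proof.
  intros Hf [c H]; exists (c^-1).
  rewrite hom_inv, <- H by assumption; grp.
Qed.

(** * Positive cones *)

Definition nonneg {G : Grp} (P : G -> Prop) (g : G) : Prop := P g \/ g = 1.

Lemma nonneg_one (G : Grp) (P : G -> Prop) : nonneg P 1.
Proof. now right. Qed.

Lemma nonneg_mul (G : Grp) (P : G -> Prop) (x y : G) :
  positive_cone G P -> nonneg P x -> nonneg P y -> nonneg P (x * y).
Proof.
  intros (Hm & _) [Hx | ->] [Hy | ->]; grp.
  - left; auto.
  - now left.
  - now left.
  - now right.
Qed.

Lemma nonneg_not_neg (G : Grp) (P : G -> Prop) (g : G) :
  positive_cone G P -> nonneg P g -> ~ P (g^-1).
Proof.
  intros (_ & _ & Hn & _ & H1) [Hg | ->] H; [apply (Hn g) | apply H1]; auto.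
Qed.

Lemma not_neg_nonneg (G : Grp) (P : G -> Prop) (g : G) :
  positive_cone G P -> ~ P (g^-1) -> nonneg P g.
Proof. intros (_ & Ht & _) H; destruct (Ht g) as [|[|]]; [left|tauto|right]; auto. Qed.

Lemma cone_pullback (H G : Grp) (f : H -> G) (P : G -> Prop) :
  is_hom f -> injective f -> positive_cone G P ->
  positive_cone H (fun h => P (f h)).
Proof.
  intros Hf Hi (Hm & Ht & Hn & H1 & H1').
  repeat split; cbn.
  - intros x y Hx Hy; rewrite Hf; auto.
  - intros g; rewrite hom_inv by assumption.
    destruct (Ht (f g)) as [|[|E]]; auto.
    do 2 right; apply Hi; now rewrite E, hom_one.
  - intros g; rewrite hom_inv by assumption; apply Hn.
  - now rewrite hom_one.
  - now rewrite ginv_one, hom_one.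
Qed.

(** A conjugate of a nontrivial element is nontrivial, so it or its inverse is positive. In the
    left-invariant order this puts [d] below [x * d] or below [x^-1 * d]. *)
Lemma cone_conj (G : Grp) (P : G -> Prop) (x d : G) : positive_cone G P -> x <> 1 ->
  P (d^-1 * (x * d)) \/ P (d^-1 * (x^-1 * d)).
Proof.
  intros (_ & Ht & _) Hx.
  destruct (Ht (d^-1 * (x * d))) as [H | [H | H]]; [now left | right; revert H; grp |].
  exfalso; apply Hx.
  apply (f_equal (fun z => d * z * d^-1)) in H; revert H; grp.
Qed.

Lemma list_upper_bound (G : Grp) (P : G -> Prop) (F : list G) : positive_cone G P ->
  exists f, forall x, In x F -> nonneg P (x^-1 * f).
Proof.
  intros HP; induction F as [| y F [f IH]]; [exists 1; now intros x []|].
  destruct (classic (nonneg P (y^-1 * f))) as [H | H].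
  - exists f; intros x [<- | Hx]; auto.
  - assert (Hf : nonneg P (f^-1 * y)).
    { apply not_neg_nonneg; auto; contradict H; left; revert H; grp. }
    exists y; intros x [<- | Hx]; [right; grp|].
    replace (x^-1 * y) with ((x^-1 * f) * (f^-1 * y)) by grp.
    apply nonneg_mul; auto.
Qed.

(** Induction on the radius avoids listing the ball: [u <= f] gives [s * u <= s * f] by left
    invariance, so a bound for [f] and the finitely many [s * f] serves the next radius. *)
Lemma ball_upper_bound (G : Grp) (P : G -> Prop) (X : list G) (r : nat) :
  positive_cone G P ->
  exists f, forall w, length w <= r -> Forall (letter X) w -> nonneg P ((wprod w)^-1 * f).
Proof.
  intros HP; induction r as [| r [f IH]].
  - exists 1; intros [| s w] Hw _; [right; cbn; grp | cbn in Hw; lia].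
  - destruct (list_upper_bound G P (f :: map (fun s => s * f) (X ++ map ginv X)) HP)
      as [f' Hf'].
    exists f'; intros [| s w] Hl Hw.
    + cbn; replace (1^-1 * f') with ((wprod [])^-1 * f * (f^-1 * f')) by (cbn; grp).
      apply nonneg_mul; auto; [apply IH; cbn; auto; lia | apply Hf'; now left].
    + inversion_clear Hw as [| ? ? Hs Hw']; cbn in Hl.
      change (wprod (s :: w)) with (s * wprod w).
      replace ((s * wprod w)^-1 * f') with
        (((wprod w)^-1 * f) * ((s * f)^-1 * f')) by grp.
      apply nonneg_mul; auto; [apply IH; auto; lia |].
      apply Hf'; right; apply in_map_iff; exists s; split; auto.
      apply in_or_app; destruct Hs as [Hs | Hs]; [now left | right].
      apply in_map_iff; exists (s^-1); grp.
Qed.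

(** * Word metrics and paths *)

Lemma letter_inv (G : Grp) (X : list G) (x : G) : letter X x -> letter X (x^-1).
Proof. intros [H | H]; [right; now rewrite ginv_inv | now left]. Qed.

Lemma wprod_cons (G : Grp) (x : G) (w : list G) : wprod (x :: w) = x * wprod w.
Proof. reflexivity. Qed.

Lemma wprod_app (G : Grp) (v w : list G) : wprod (v ++ w) = wprod v * wprod w.
Proof. induction v as [| x v IH]; [cbn; grp|]. rewrite <- app_comm_cons, !wprod_cons, IH; grp. Qed.

Lemma word_inv (G : Grp) (X w : list G) : Forall (letter X) w ->
  exists w', length w' = length w /\ Forall (letter X) w' /\ wprod w' = (wprod w)^-1.
Proof.
  induction 1 as [| x w Hx Hw (w' & Hl & Hw' & E)].
  - exists []; cbn; grp.
  - exists (w' ++ [x^-1]); repeat split.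
    + rewrite length_app, Hl; cbn; lia.
    + apply Forall_app; auto using letter_inv.
    + rewrite wprod_app, !wprod_cons, E; cbn; grp.
Qed.

Lemma dist_le_refl (G : Grp) (X : list G) (x : G) (r : nat) : dist_le X x x r.
Proof. exists []; cbn; repeat split; auto; [lia | grp]. Qed.

Lemma dist_le_mono (G : Grp) (X : list G) (x y : G) (r r' : nat) :
  r <= r' -> dist_le X x y r -> dist_le X x y r'.
Proof. intros Hr (w & Hl & Hw & E); exists w; repeat split; auto; lia. Qed.

Lemma dist_le_sym (G : Grp) (X : list G) (x y : G) (r : nat) :
  dist_le X x y r -> dist_le X y x r.
Proof.
  intros (w & Hl & Hw & <-).
  destruct (word_inv G X w Hw) as (w' & Hl' & Hw' & E).
  exists w'; rewrite E, Hl'; grp.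
Qed.

Lemma dist_le_trans (G : Grp) (X : list G) (x y z : G) (r s : nat) :
  dist_le X x y r -> dist_le X y z s -> dist_le X x z (r + s).
Proof.
  intros (v & Hlv & Hv & <-) (w & Hlw & Hw & <-).
  exists (v ++ w); rewrite length_app, Forall_app, wprod_app.
  repeat split; auto; [lia | grp].
Qed.

Lemma dist_le_mul_l (G : Grp) (X : list G) (a x y : G) (r : nat) :
  dist_le X x y r -> dist_le X (a * x) (a * y) r.
Proof. intros (w & Hl & Hw & <-); exists w; grp. Qed.

Lemma generates_dist (G : Grp) (X : list G) (x : G) :
  generates X -> exists r, dist_le X 1 x r.
Proof.
  intros HX; destruct (HX x) as (w & Hw & <-).
  exists (length w), w; repeat split; auto; grp.
Qed.

Lemma generates_dist_all (G : Grp) (X F : list G) :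
  generates X -> exists r, forall x, In x F -> dist_le X 1 x r.
Proof.
  intros HX; induction F as [| y F [r IH]]; [exists 0; now intros x []|].
  destruct (generates_dist G X y HX) as [s Hs].
  exists (max r s); intros x [<- | Hx].
  - apply dist_le_mono with s; auto; lia.
  - apply dist_le_mono with r; auto; lia.
Qed.

Lemma hom_lipschitz (G K : Grp) (f : G -> K) (X : list G) (Y : list K) :
  is_hom f -> generates Y ->
  exists L, forall x y r, dist_le X x y r -> dist_le Y (f x) (f y) (r * L)%nat.
Proof.
  intros Hf HY; destruct (generates_dist_all K Y (map f X) HY) as [L HL].
  exists L; intros x y r (w & Hl & Hw & <-).
  apply dist_le_mono with (length w * L)%nat; [now apply Nat.mul_le_mono_r|].
  clear r Hl; revert x; induction Hw as [| s w Hs Hw IH]; intros x.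
  - cbn; rewrite gmul_1r; apply dist_le_refl.
  - apply dist_le_trans with (f (x * s)); [| now rewrite wprod_cons, gmul_assoc].
    rewrite Hf; rewrite <- (gmul_1r _ (f x)) at 1; apply dist_le_mul_l.
    destruct Hs as [Hs | Hs]; [now apply HL, in_map|].
    apply dist_le_sym; rewrite <- (gmul_Vr _ (f s)), <- (gmul_1r _ (f s)) at 1.
    apply dist_le_mul_l; rewrite <- hom_inv by assumption.
    now apply HL, in_map.
Qed.

(** A path from [x] is stored as the list of its later points; the default of [last] is therefore
    the starting point. *)
Lemma last_cons_default (T : Type) (x y : T) (l : list T) : last (y :: l) x = last l y.
Proof.
  revert x y; induction l as [| z l IH]; intros x y; [easy|].
  change (last (z :: l) x = last (z :: l) y); now rewrite (IH x z), (IH y z).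
Qed.

(** Joinability by [r]-paths in [S], as a closure, so that reversal, concatenation and images need
    no lists. Reflexivity links even a point outside [S] to itself. *)
Definition linked {G : Grp} (X : list G) (r : nat) (S : G -> Prop) : relation G :=
  clos_refl_trans G (fun x y => S x /\ S y /\ dist_le X x y r).

Lemma linked_path (G : Grp) (X : list G) (r : nat) (S : G -> Prop) (x y : G) :
  linked X r S x y -> exists l, rpath X r x l /\ last l x = y /\ Forall S l.
Proof.
  intros H; apply clos_rt_rt1n in H.
  induction H as [x | x y z (Hx & Hy & Hd) _ (l & Hl & E & Hf)].
  - now exists [].
  - exists (y :: l); rewrite last_cons_default; split; [now split|]; auto.
Qed.

Lemma path_linked (G : Grp) (X : list G) (r : nat) (S : G -> Prop) (x : G) (l : list G) :
  rpath X r x l -> S x -> Forall S l -> linked X r S x (last l x).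
Proof.
  intros Hp Hx Hl; revert x Hp Hx; induction Hl as [| y l Hy Hl IH]; intros x Hp Hx.
  - apply rt_refl.
  - rewrite last_cons_default; destruct Hp as [Hd Hp].
    apply rt_trans with y; [now apply rt_step | now apply IH].
Qed.

Lemma linked_sym (G : Grp) (X : list G) (r : nat) (S : G -> Prop) (x y : G) :
  linked X r S x y -> linked X r S y x.
Proof.
  induction 1 as [x y (Hx & Hy & Hd) | |]; [| apply rt_refl | eapply rt_trans; eauto].
  apply rt_step; auto using dist_le_sym.
Qed.

Lemma linked_map (G K : Grp) (X : list G) (Y : list K) (r s : nat)
    (S : G -> Prop) (T : K -> Prop) (f : G -> K) (x y : G) :
  (forall u, S u -> T (f u)) ->
  (forall u v, dist_le X u v r -> dist_le Y (f u) (f v) s) ->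
  linked X r S x y -> linked Y s T (f x) (f y).
Proof.
  intros HS Hd; induction 1 as [u v (Hu & Hv & Huv) | |];
    [apply rt_step; auto | apply rt_refl | eapply rt_trans; eauto].
Qed.

(** A path of nonnegative points would have to meet [S], all of whose points are negative. Steps
    shorter than the width of the swamp do not help. *)
Lemma disconnects_not_linked (G : Grp) (X : list G) (r r' : nat) (P S H1 H2 : G -> Prop)
    (x y : G) :
  positive_cone G P -> (forall g, S g -> P (g^-1)) -> r_disconnects X r S H1 H2 ->
  H1 x -> H2 y -> nonneg P x -> r' <= r -> ~ linked X r' (nonneg P) x y.
Proof.
  intros HP HS Hd Hx Hy Nx Hr Hl.
  assert (Hl' : linked X r (nonneg P) x y).
  { revert Hl; apply (linked_map _ _ _ _ _ _ _ _ (fun g => g)); auto.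
    intros u v; now apply dist_le_mono. }
  destruct (linked_path _ _ _ _ _ _ Hl') as (l & Hp & E & Hf).
  subst y; destruct (Hd x l Hx Hy Hp) as (z & Hz & HSz).
  apply (nonneg_not_neg G P z HP); auto.
  destruct Hz as [-> | Hz]; auto.
  rewrite Forall_forall in Hf; auto.
Qed.

(** Adjoining 1 to a coarsely connected cone costs only the distance from 1 to one fixed positive
    element. *)
Lemma nonneg_linked_one (C : Grp) (X : list C) (P : C -> Prop) :
  generates X -> coarsely_connected X P ->
  exists r, forall c, nonneg P c -> linked X r (nonneg P) 1 c.
Proof.
  intros HX [r Hr]; destruct (classic (exists p, P p)) as [[p Hp] | Hn].
  - destruct (generates_dist C X p HX) as [s Hs].
    exists (max r s); intros c [Hc | ->]; [| apply rt_refl].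
    apply rt_trans with p.
    + apply rt_step; repeat split; [apply nonneg_one | now left |].
      apply dist_le_mono with s; auto; lia.
    + destruct (Hr p c Hp Hc) as (l & Hl & <- & Hf).
      apply (linked_map _ _ X X r (max r s) P _ (fun g => g)).
      * now left.
      * intros u v; apply dist_le_mono; lia.
      * now apply path_linked.
  - exists 0; intros c [Hc | ->]; [exfalso; eauto | apply rt_refl].
Qed.

(* The trace of the cone on a coset [a C] is an upper set of [a C], and any two points
   of it lie in the translate of a cone of [C] by the smaller one. *)
Lemma coset_linked (A C : Grp) (psi : C -> A) (X : list A) (P : A -> Prop) :
  Prieto C -> is_hom psi -> injective psi -> generates X -> positive_cone A P ->
  exists r, forall a c, nonneg P a -> nonneg P (a * psi c) ->
    linked X r (nonneg P) a (a * psi c).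
Proof.
  intros (_ & Y & HY & HC) Hpsi Hinj HX HP.
  assert (HQ : positive_cone C (fun c => P (psi c))) by now apply cone_pullback.
  destruct (nonneg_linked_one C Y _ HY (HC _ HQ)) as [r Hr].
  destruct (hom_lipschitz C A psi Y X Hpsi HX) as [L HL].
  exists (r * L)%nat.
  (* A path from 1 to [c] in the induced cone of [C], mapped to [A] and translated by [a >= 1],
     stays nonnegative; its steps grow by at most the factor [L]. *)
  assert (up : forall a c, nonneg P a -> nonneg (fun c => P (psi c)) c ->
             linked X (r * L)%nat (nonneg P) a (a * psi c)).
  { intros a c Ha Hc.
    rewrite <- (gmul_1r _ a) at 1; rewrite <- (hom_one _ _ psi Hpsi).
    revert Hc; intros Hc%Hr; revert Hc.
    apply (linked_map _ _ _ _ _ _ _ _ (fun c => a * psi c)).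
    - intros d [Hd | ->]; [apply nonneg_mul; auto; now left|].
      rewrite hom_one; grp.
    - intros u v Huv; apply dist_le_mul_l; auto. }
  intros a c Ha Hac.
  destruct (classic (P (psi c^-1))) as [Hn | Hn].
  - apply linked_sym.
    replace a with (a * psi c * psi (c^-1)) at 2 by (rewrite hom_inv; grp).
    apply up; auto; now left.
  - apply up; auto; now apply not_neg_nonneg.
Qed.

(* The swamp is the whole negative cone. *)
Lemma Hucha_of_separated (G : Grp) (X : list G) : left_orderable G -> generates X ->
  (forall P, positive_cone G P -> forall r, exists u v, P u /\ P v /\
     forall l, rpath X r u l -> last l u = v -> ~ Forall (nonneg P) l) ->
  Hucha G.
Proof.
  intros HG HX Hsep; split; auto; exists X; split; auto.
  intros P HP H HH r _; destruct (Hsep P HP r) as (u & v & Hu & Hv & Huv).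
  assert (Hd : forall x l, x = u -> last l x = v -> rpath X r x l ->
             exists y, (y = x \/ In y l) /\ P (y^-1)).
  { intros x l -> E Hl; apply NNPP; intros Hn; apply (Huv l); auto.
    apply Forall_forall; intros y Hy; apply not_neg_nonneg; auto.
    intros Hy'; apply Hn; exists y; auto. }
  exists (fun g => P (g^-1)); repeat split; auto.
  - exists u, v; auto.
  (* Cosets of the trivial subgroup are points, so the same pair serves again. *)
  - exists u, v; intros x l (h & Hh & E) (h' & Hh' & E').
    apply HH in Hh, Hh'; subst h h'; rewrite gmul_1r in E, E'; auto.
Qed.

(** * Coset excursions *)

(* [D true] and [D false] are the sets of elements lying beyond the two kinds of edges at the
   vertex [j A] of the Bass-Serre tree, [psi e] embedding the stabilizer of such an edge. *)
Lemma Hucha_of_branches (A C G : Grp) (j : A -> G) (psi : bool -> C -> A)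
    (D : bool -> G -> Prop) (XA : list A) (X : list G) :
  left_orderable G -> is_hom j -> injective j ->
  (forall e, is_hom (psi e)) -> (forall e, injective (psi e)) ->
  generates XA -> generates X -> Prieto C ->
  (forall P, positive_cone A P -> forall r, 0 < r ->
     exists S, negative_swamp XA P (fun a => exists c, psi true c = a) r S) ->
  (exists a, forall c, a <> psi true c) ->
  (forall e a, ~ D e (j a)) ->
  (forall e a z, D true z -> D e (j a * z) -> e = true /\ exists c, a = psi true c) ->
  (forall s, letter X s -> (exists a, s = j a) \/ exists e, D e s) ->
  (forall e z s, D e z -> letter X s -> D e (z * s) \/ exists c, z * s = j (psi e c)) ->
  (forall z a, D true z -> D true (z * j a)) ->
  (exists w, forall d, ~ D true d -> D true (w * d) /\ D true (w^-1 * d)) ->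
  Hucha G.
Proof.
  intros HG Hj Hji Hpsi Hpsii HXA HX HC Hswamp [a0 Ha0] Dj Dj' Dout Din Dr [w0 Hw0].
  apply (Hucha_of_separated G X); auto; intros P HP r.
  (* Inside the branch, right multiplication by [j a0] or its inverse moves [d] up without leaving.
     Outside it, both [w0] and [w0^-1] carry [d] into the branch, and one of them moves it up. *)
  assert (cofinal : forall d, exists z, D true z /\ P (d^-1 * z)).
  { intros d; destruct (classic (D true d)) as [Hd | Hd].
    - assert (Ha1 : j a0 <> 1).
      { rewrite <- (hom_one _ _ j Hj); intros E%Hji; apply (Ha0 1).
        now rewrite hom_one. }
      destruct (cone_conj G P (j a0) 1 HP Ha1) as [H | H]; revert H; grp; intros H.
      + exists (d * j a0); grp.
      + exists (d * j (a0^-1)); split; auto; rewrite hom_inv; grp.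
    - assert (Hw : w0 <> 1).
      { intros ->; destruct (Hw0 d Hd) as [H _]; revert H; grp. }
      destruct (Hw0 d Hd).
      destruct (cone_conj G P w0 d HP Hw); eauto. }
  destruct (ball_upper_bound G P X r HP) as [f Hf].
  (* Every point [x] crossed by an [r]-path of nonnegative elements satisfies [x f >= 1],
     that is, [f x] is nonnegative for the conjugate cone [Q = f P f^-1]. *)
  set (Q := fun g => P (f^-1 * g * f)).
  assert (HQ : positive_cone G Q).
  { exact (cone_pullback G G _ P (hom_conj G f) (conj_injective G f) HP). }
  set (QA := fun a => Q (j a)).
  assert (HQA : positive_cone A QA) by exact (cone_pullback A G j Q Hj Hji HQ).
  assert (nonneg_j : forall a, nonneg Q (j a) -> nonneg QA a).
  { intros a [H | H]; [now left | right].
    apply Hji; now rewrite H, hom_one. }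
  destruct (coset_linked A C (psi true) XA QA HC) as [R1 HR1]; auto.
  destruct (coset_linked A C (psi false) XA QA HC) as [R2 HR2]; auto.
  (* [K] bounds the length in [A] of the finitely many letters of [X] that lie in [j A]. *)
  assert (HK : exists K, forall s a, letter X s -> s = j a -> dist_le XA 1 a K).
  { assert (H : forall F : list G, exists K, forall s a, In s F -> s = j a -> dist_le XA 1 a K).
    { intros F; induction F as [| s F [K IH]]; [exists 0; now intros s a []|].
      destruct (classic (exists a, s = j a)) as [[a Ha] | Hn].
      - destruct (generates_dist A XA a HXA) as [K' HK'].
        exists (max K K'); intros s' a' [<- | Hs'] E.
        + rewrite Ha in E; apply Hji in E; subst a'.
          apply dist_le_mono with K'; auto; lia.
        + apply dist_le_mono with K; [lia | eauto].
      - exists K; intros s' a' [<- | Hs'] E; [exfalso; eauto | eauto]. }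
    destruct (H (X ++ map ginv X)) as [K HK]; exists K; intros s a Hs; apply HK.
    apply in_or_app; destruct Hs as [Hs | Hs]; [now left | right].
    apply in_map_iff; exists (s^-1); grp. }
  destruct HK as [K HK].
  (* Large enough for paths in cosets of both edge groups and for letters from [A]; the successor
     makes the width positive. *)
  set (R := S (R1 + R2 + K)).
  set (near := linked XA R (nonneg QA)).
  assert (near_coset : forall e a c, nonneg QA a -> nonneg QA (a * psi e c) ->
             near a (a * psi e c)).
  { intros e a c Ha Hac.
    apply (linked_map _ _ XA XA (if e then R1 else R2) R (nonneg QA) _ (fun g => g)); auto.
    - intros u v; apply dist_le_mono; unfold R; destruct e; lia.
    - destruct e; auto. }
  destruct (Hswamp QA HQA R) as (S & HS & _ & g1 & g2' & Hg'); [unfold R; lia|].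
  (* The cosets must also be distinct, so that the branches hanging from them are disjoint. *)
  assert (Hg : exists g2, (forall c, g1^-1 * g2 <> psi true c) /\ forall c c',
             nonneg QA (g1 * psi true c) -> ~ near (g1 * psi true c) (g2 * psi true c')).
  { assert (Hn : forall c c', nonneg QA (g1 * psi true c) ->
               ~ near (g1 * psi true c) (g2' * psi true c')).
    { intros c c' Hc; apply (disconnects_not_linked A XA R R QA S _ _ _ _ HQA HS Hg'); auto.
      - exists (psi true c); split; eauto.
      - exists (psi true c'); split; eauto. }
    destruct (classic (exists c, g1^-1 * g2' = psi true c)) as [[d Hd] | Hd].
    - (* The two cosets coincide and hence are negative; any other coset serves as [g2]. *)
      exists (g1 * a0); split; [intros c; grp|].
      intros c c' Hc _; apply (Hn c (d^-1 * c) Hc).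
      replace (g2' * psi true (d^-1 * c)) with (g1 * psi true c); [apply rt_refl|].
      rewrite <- (gmulVK _ g1 g2'), Hd, (Hpsi true), hom_inv by auto; grp.
    - exists g2'; split; [intros c E; eauto | auto]. }
  clear g2' Hg' HS S Hswamp; destruct Hg as (g2 & Hg & Hsep).
  (* Cofinality makes the endpoints [f^-1 * j g1 * z1] and [f^-1 * j g2 * z2] positive while they
     lie in the two chosen branches. *)
  destruct (cofinal ((f^-1 * j g1)^-1)) as (z1 & Hz1 & Pz1).
  destruct (cofinal ((f^-1 * j g2)^-1)) as (z2 & Hz2 & Pz2).
  rewrite ginv_inv in Pz1, Pz2.
  eexists _, _; split; [exact Pz1 | split; [exact Pz2|]].
  intros l Hl El Nl.
  (* Seen from the coset [f^-1 A], the path is still in the starting branch, or it is in or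
     beyond a point [a] of [A] that [QA]-nonnegative elements link to the coset [g1 C]. *)
  set (state := fun x => (exists z, f * x = j g1 * z /\ D true z) \/
    exists c a z, f * x = j a * z /\ (z = 1 \/ exists e, D e z) /\
      nonneg QA (g1 * psi true c) /\ nonneg QA a /\ near (g1 * psi true c) a).
  (* Conjugating [f * x] back by [f] gives [x * f]. *)
  assert (Nf : forall x, nonneg P (x * f) -> nonneg Q (f * x)).
  { intros x [H | H]; [left | right].
    - unfold Q; revert H; grp.
    - apply (f_equal (fun y => f * y * f^-1)) in H; revert H; grp. }
  assert (state_letter : forall x s, letter X s -> nonneg P (x * s * f) -> state x ->
             state (x * s)).
  { intros x s Hs Nx%Nf [(z & E & Hz) | (c & a & z & E & Hz & Nc & Na & Hca)].
    - rewrite gmul_assoc in Nx; rewrite E in Nx.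
      destruct (Din true z s Hz Hs) as [H | [c H]].
      + left; exists (z * s); rewrite gmul_assoc, E; grp.
      (* Leaving the starting branch, the path lands on a nonnegative point of [g1 C], which becomes
         the reference point. *)
      + right; exists c, (g1 * psi true c), 1.
        rewrite <- gmul_assoc, H, <- Hj in Nx; apply nonneg_j in Nx.
        repeat split; auto; [| apply rt_refl].
        rewrite gmul_assoc, E, <- gmul_assoc, H, Hj; grp.
    - right; rewrite gmul_assoc in Nx; rewrite E in Nx.
      destruct Hz as [-> | [e He]].
      + destruct (Dout s Hs) as [[b Hb] | [e He]].
        * exists c, (a * b), 1.
          rewrite gmul_1r, Hb, <- Hj in Nx; apply nonneg_j in Nx.
          repeat split; auto.
          -- rewrite gmul_assoc, E, Hb, Hj; grp.
          -- apply rt_trans with a; auto; apply rt_step; repeat split; auto.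
             rewrite <- (gmul_1r _ a) at 1; apply dist_le_mul_l.
             apply dist_le_mono with K; [unfold R; lia | eauto].
        * exists c, a, s; repeat split; eauto.
          rewrite gmul_assoc, E; grp.
      + destruct (Din e z s He Hs) as [H | [d H]].
        * exists c, a, (z * s); repeat split; eauto.
          rewrite gmul_assoc, E; grp.
        (* End of an excursion: the exit [a] and the return [a * psi e d] are nonnegative points of
           one edge coset, so [near_coset] gives a detour inside [A]. *)
        * exists c, (a * psi e d), 1.
          rewrite <- gmul_assoc, H, <- Hj in Nx; apply nonneg_j in Nx.
          repeat split; auto.
          -- rewrite gmul_assoc, E, <- gmul_assoc, H, Hj; grp.
          -- apply rt_trans with a; [exact Hca | now apply near_coset]. }
  assert (state_word : forall w x, length w <= r -> Forall (letter X) w ->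
             nonneg P (x * wprod w) -> state x -> state (x * wprod w)).
  { intros w; induction w as [| s w IH]; intros x Hlen Hw Nx Hx; [cbn; now rewrite gmul_1r|].
    inversion_clear Hw as [| ? ? Hs Hw']; cbn in Hlen.
    rewrite wprod_cons, gmul_assoc in *.
    apply IH; auto; [lia|]; apply state_letter; auto.
    (* The intermediate point [x * s] may be negative, but the end of the step is nonnegative and
       [f] dominates the remaining word [w]. *)
    replace (x * s * f) with ((x * s * wprod w) * ((wprod w)^-1 * f)) by grp.
    apply nonneg_mul; auto; apply Hf; auto; lia. }
  assert (state_path : forall l x, rpath X r x l -> Forall (nonneg P) l -> state x ->
             state (last l x)).
  { clear - state_word.
    intros l; induction l as [| y l IH]; intros x Hl Nl Hx; [easy|].
    rewrite last_cons_default; destruct Hl as [(w & Hlen & Hw & <-) Hl].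
    inversion_clear Nl; apply IH; auto. }
  assert (Hend : state (f^-1 * j g2 * z2)).
  { rewrite <- El; apply state_path; auto.
    left; exists z1; split; auto; grp. }
  destruct Hend as [(z & E & Hz) | (c & a & z & E & Hz & Nc & Na & Hca)].
  (* If the path never left the starting branch, the two branches meet and the cosets coincide. *)
  - destruct (Dj' true (g1^-1 * g2) z2) as [_ [c Hc]]; auto; [| now apply (Hg c)].
    rewrite Hj, hom_inv by auto.
    replace ((j g1)^-1 * j g2 * z2) with ((j g1)^-1 * (f * (f^-1 * j g2 * z2))) by grp.
    rewrite E; grp.
  - assert (E' : z = j (a^-1 * g2) * z2).
    { rewrite Hj, hom_inv by auto.
      replace z with ((j a)^-1 * (j a * z)) by grp.
      rewrite <- E; grp. }
    destruct Hz as [Hz | [e He]].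
    + apply (Dj true (g2^-1 * a)).
      replace (j (g2^-1 * a)) with z2; auto.
      rewrite Hj, hom_inv in * by auto.
      apply (gmul_cancel _ ((j a)^-1 * j g2)); rewrite <- E', Hz; grp.
    (* The last excursion enters the branch of [z2], so it leaves from a point [a] of [g2 C], and
       this point is linked to [g1 C]. *)
    + rewrite E' in He; destruct (Dj' e _ z2 Hz2 He) as [-> [d Hd]].
      apply (Hsep c (d^-1)); auto.
      replace (g2 * psi true (d^-1)) with a; auto.
      rewrite hom_inv, <- Hd by auto; grp.
Qed.

(** * Generation by universal properties *)

Definition span {G : Grp} (X : list G) (g : G) : Prop :=
  exists w, Forall (letter X) w /\ wprod w = g.

Lemma span_mul (G : Grp) (X : list G) (x y : G) : span X x -> span X y -> span X (x * y).
Proof.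
  intros (v & Hv & <-) (w & Hw & <-); exists (v ++ w).
  rewrite wprod_app; split; auto; now apply Forall_app.
Qed.

Lemma span_inv (G : Grp) (X : list G) (x : G) : span X x -> span X (x^-1).
Proof.
  intros (w & Hw & <-); destruct (word_inv G X w Hw) as (w' & _ & Hw' & E); now exists w'.
Qed.

Lemma span_one (G : Grp) (X : list G) : span X 1.
Proof. now exists []. Qed.

Lemma span_in (G : Grp) (X : list G) (x : G) : In x X -> span X x.
Proof.
  intros Hx; exists [x]; split; [| cbn; grp].
  constructor; auto; now left.
Qed.

Lemma span_hom (G H : Grp) (f : H -> G) (X : list G) (Y : list H) :
  is_hom f -> generates Y -> (forall y, In y Y -> In (f y) X) -> forall h, span X (f h).
Proof.
  intros Hf HY HYX h; destruct (HY h) as (w & Hw & <-).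
  induction Hw as [| s w Hs Hw IH]; [cbn; rewrite hom_one; auto using span_one|].
  rewrite wprod_cons, Hf; apply span_mul; auto.
  destruct Hs as [Hs | Hs]; [now apply span_in, HYX|].
  rewrite <- (ginv_inv _ s), hom_inv by auto; now apply span_inv, span_in, HYX.
Qed.

Lemma generates_ind (G : Grp) (X : list G) (Q : G -> Prop) : generates X ->
  Q 1 -> (forall g s, letter X s -> Q g -> Q (g * s)) -> forall g, Q g.
Proof.
  intros HX Q1 Qs g; destruct (HX g) as (w & Hw & <-).
  rewrite <- (gmul_1l _ (wprod w)); revert Q1; generalize (1 : G).
  induction Hw as [| s w Hs Hw IH]; intros x Hx; [cbn; now rewrite gmul_1r|].
  rewrite wprod_cons, gmul_assoc; auto.
Qed.

(** The subgroup generated by [X], made a group in its own right so that it can be the target of a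
    universal property. *)
Definition span_grp (G : Grp) (X : list G) : Grp.
Proof.
  refine {|
    gcar := {g : G | span X g};
    gmul := fun x y => exist _ (proj1_sig x * proj1_sig y)
                         (span_mul G X _ _ (proj2_sig x) (proj2_sig y));
    ginv := fun x => exist _ ((proj1_sig x)^-1) (span_inv G X _ (proj2_sig x));
    gone := exist _ 1 (span_one G X) |};
    intros; apply eq_sig_hprop; cbn; grp; intros; apply proof_irrelevance.
Defined.

Lemma span_grp_retract_generates (G : Grp) (X : list G) (h : G -> span_grp G X) :
  (forall g, proj1_sig (h g) = g) -> generates X.
Proof. intros Hh g; rewrite <- (Hh g); apply proj2_sig. Qed.

(** The universal property maps [G] to the subgroup spanned by the list. Followed by the inclusion
    this is the identity, by uniqueness, so the subgroup is all of [G]. *)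
Lemma HNN_generates (A C G : Grp) (i phi : C -> A) (j : A -> G) (t : G) (XA : list A) :
  is_HNN A C i phi G j t -> generates XA -> generates (t :: map j XA).
Proof.
  intros (Hj & Ht & Hu) HXA; set (X := t :: map j XA).
  assert (Hspan : forall a, span X (j a)).
  { apply (span_hom G A j X XA); auto; intros y Hy; right; now apply in_map. }
  destruct (Hu (span_grp G X) (fun a => exist _ (j a) (Hspan a))
              (exist _ t (span_in G X t (or_introl eq_refl)))) as (h & (Hh & Hhj & Hht) & _).
  - intros x y; apply eq_sig_hprop; cbn; auto; intros; apply proof_irrelevance.
  - intros c; apply eq_sig_hprop; cbn; auto; intros; apply proof_irrelevance.
  - apply (span_grp_retract_generates G X h); intros g.
    destruct (Hu G j t Hj Ht) as (h0 & _ & Huniq).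
    rewrite (Huniq (fun g => proj1_sig (h g))).
    + symmetry; apply (Huniq (fun g => g)); auto; easy.
    + intros x y; now rewrite Hh.
    + intros a; now rewrite Hhj.
    + now rewrite Hht.
Qed.

Lemma amalgam_generates (A B C G : Grp) (iA : C -> A) (iB : C -> B)
    (jA : A -> G) (jB : B -> G) (XA : list A) (XB : list B) :
  is_amalgam A B C iA iB G jA jB -> generates XA -> generates XB ->
  generates (map jA XA ++ map jB XB).
Proof.
  intros (HjA & HjB & Hc & Hu) HXA HXB; set (X := map jA XA ++ map jB XB).
  assert (HsA : forall a, span X (jA a)).
  { apply (span_hom G A jA X XA); auto; intros y Hy.
    apply in_or_app; left; now apply in_map. }
  assert (HsB : forall b, span X (jB b)).
  { apply (span_hom G B jB X XB); auto; intros y Hy.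
    apply in_or_app; right; now apply in_map. }
  destruct (Hu (span_grp G X) (fun a => exist _ (jA a) (HsA a))
              (fun b => exist _ (jB b) (HsB b))) as (h & (Hh & HhA & HhB) & _).
  - intros x y; apply eq_sig_hprop; cbn; auto; intros; apply proof_irrelevance.
  - intros x y; apply eq_sig_hprop; cbn; auto; intros; apply proof_irrelevance.
  - intros c; apply eq_sig_hprop; cbn; auto; intros; apply proof_irrelevance.
  - apply (span_grp_retract_generates G X h); intros g.
    destruct (Hu G jA jB HjA HjB Hc) as (h0 & _ & Huniq).
    rewrite (Huniq (fun g => proj1_sig (h g))).
    + symmetry; apply (Huniq (fun g => g)); auto; easy.
    + intros x y; now rewrite Hh.
    + intros a; now rewrite HhA.
    + intros b; now rewrite HhB.
Qed.

(** * Permutation actions on normal forms *)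

Record perm (T : Type) := {
  pfun : T -> T;
  pinv : T -> T;
  pfunK : forall x, pinv (pfun x) = x;
  pinvK : forall x, pfun (pinv x) = x
}.
Arguments pfun {T}.
Arguments pinv {T}.

Lemma perm_ext (T : Type) (p q : perm T) : (forall x, pfun p x = pfun q x) -> p = q.
Proof.
  destruct p as [f f' Hf Hf'], q as [g g' Hg Hg']; cbn; intros E.
  assert (f = g) by now apply functional_extensionality.
  subst g; assert (f' = g').
  { apply functional_extensionality; intros x; now rewrite <- (Hg' x) at 1. }
  subst g'; f_equal; apply proof_irrelevance.
Qed.

(** Actions of the pieces on [T] become homomorphisms to this group, which the universal property
    extends to [G]. *)
Definition perm_grp (T : Type) : Grp.
Proof.
  refine {|
    gcar := perm T;
    gmul := fun p q => {| pfun := fun x => pfun p (pfun q x);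
                          pinv := fun x => pinv q (pinv p x) |};
    ginv := fun p => {| pfun := pinv p; pinv := pfun p |};
    gone := {| pfun := fun x => x; pinv := fun x => x |} |}.
  Unshelve.
  all: intros; try apply perm_ext; cbn; intros; now rewrite ?pfunK, ?pinvK.
Defined.

Definition is_action {A : Grp} {T : Type} (act : A -> T -> T) : Prop :=
  (forall x, act 1 x = x) /\ (forall a b x, act (a * b) x = act a (act b x)).

Lemma action_hom (A : Grp) (T : Type) (act : A -> T -> T) : is_action act ->
  exists f : A -> perm_grp T, is_hom f /\ forall a x, pfun (f a : perm T) x = act a x.
Proof.
  intros [H1 Hm].
  assert (HK : forall a x, act (a^-1) (act a x) = x) by (intros; now rewrite <- Hm, gmul_Vl).
  assert (HK' : forall a x, act a (act (a^-1) x) = x) by (intros; now rewrite <- Hm, gmul_Vr).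
  exists (fun a => {| pfun := act a; pinv := act (a^-1); pfunK := HK a; pinvK := HK' a |}).
  split; [| easy].
  intros a b; apply perm_ext; cbn; auto.
Qed.

(* [U] indexes the nontrivial right cosets of [psi C] in [A]. *)
Lemma transversal (A C : Grp) (psi : C -> A) : is_hom psi -> injective psi ->
  exists (U : Type) (enc : C -> option U -> A) (dec : A -> C * option U),
    (forall c, enc c None = psi c) /\
    (forall c d u, enc (c * d) u = psi c * enc d u) /\
    (forall c u, dec (enc c u) = (c, u)) /\
    (forall a, enc (fst (dec a)) (snd (dec a)) = a).
Proof.
  intros Hpsi Hinj.
  (* The choice depends only on the coset, because equivalent predicates are equal by
     extensionality. *)
  set (rep := fun a => epsilon (inhabits (1 : A)) (fun b => exists c, b = psi c * a)).
  assert (rep_spec : forall a, exists c, rep a = psi c * a).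
  { intros a; apply (epsilon_spec (inhabits (1 : A)) (fun b => exists c, b = psi c * a)).
    exists a, 1; rewrite hom_one; grp. }
  assert (rep_mul : forall c a, rep (psi c * a) = rep a).
  { intros c a; unfold rep; f_equal.
    apply functional_extensionality; intros b; apply propositional_extensionality.
    split; intros [d ->].
    - exists (d * c); rewrite Hpsi; grp.
    - exists (d * c^-1); rewrite Hpsi, hom_inv by auto; grp. }
  (* The coset [psi C] is encoded by [None], with representative 1, and is therefore left out of
     [U]. *)
  set (U := {u : A | rep u = u /\ ~ exists c, u = psi c}).
  set (enc := fun (c : C) (o : option U) =>
         match o with None => psi c | Some u => psi c * proj1_sig u end).
  assert (enc_inj : forall c u d v, enc c u = enc d v -> (c, u) = (d, v)).
  { intros c [[u [Ru Nu]]|] d [[v [Rv Nv]]|]; cbn; intros E.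
    - assert (u = v) as <-.
      { now rewrite <- Ru, <- Rv, <- (rep_mul c u), E, rep_mul. }
      assert (c = d) as <-.
      { apply Hinj; apply (f_equal (fun x => x * u^-1)) in E; revert E; grp. }
      f_equal; f_equal; apply eq_sig_hprop; auto; intros; apply proof_irrelevance.
    - exfalso; apply Nu, (image_mul_l A C psi c); eauto.
    - exfalso; apply Nv, (image_mul_l A C psi d); eauto.
    - now apply Hinj in E; subst. }
  assert (enc_surj : forall a, exists p, enc (fst p) (snd p) = a).
  { intros a; destruct (classic (exists c, a = psi c)) as [[c ->] | Hn].
    - now exists (c, None).
    - destruct (rep_spec a) as [c Hc].
      assert (Hr : rep (rep a) = rep a /\ ~ exists d, rep a = psi d).
      { split; [now rewrite Hc at 1; rewrite rep_mul|].
        intros [d Hd]; apply Hn, (image_mul_l A C psi c); auto.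
        exists d; now rewrite <- Hc. }
      exists (c^-1, Some (exist _ (rep a) Hr)); cbn.
      rewrite Hc, hom_inv by auto; grp. }
  exists U, enc, (fun a => proj1_sig (constructive_indefinite_description _ (enc_surj a))).
  split; [easy | split; [| split]].
  - intros c d [u|]; cbn; rewrite Hpsi; grp.
  - intros c u; destruct constructive_indefinite_description as [[d v] E]; cbn in *.
    symmetry; now apply enc_inj.
  - intros a; now destruct constructive_indefinite_description.
Qed.

(* [fwd_word] and [bwd_word] are the reduced words of an HNN extension starting with the stable
   letter and with its inverse; the coset representatives are those of the two edge groups. *)
Inductive fwd_word (U V : Type) : Type :=
| fwd_fwd (u : option U) (w : option (fwd_word U V))
| fwd_bwd (u : U) (w : bwd_word U V)
with bwd_word (U V : Type) : Type :=
| bwd_bwd (v : option V) (w : option (bwd_word U V))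
| bwd_fwd (v : V) (w : fwd_word U V).
Arguments fwd_fwd {U V}.
Arguments fwd_bwd {U V}.
Arguments bwd_bwd {U V}.
Arguments bwd_fwd {U V}.

Inductive hnn_word (U V : Type) : Type :=
| hnn_nil | hnn_fwd (w : fwd_word U V) | hnn_bwd (w : bwd_word U V).
Arguments hnn_nil {U V}.
Arguments hnn_fwd {U V}.
Arguments hnn_bwd {U V}.

(** Left multiplication on normal forms, a head in [A] followed by a reduced word. Freeness at [o]
    will make [j] injective, and the last three clauses are a ping-pong on the sets [D e]. *)
Lemma HNN_action (A C : Grp) (psi : bool -> C -> A) :
  (forall e, is_hom (psi e)) -> (forall e, injective (psi e)) ->
  exists (T : Type) (act : A -> T -> T) (s : bool -> T -> T) (o : T) (D : bool -> T -> Prop),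
    is_action act /\
    (forall e x, s e (s (negb e) x) = x) /\
    (forall c x, s false (act (psi true c) x) = act (psi false c) (s false x)) /\
    (forall a b, act a o = act b o -> a = b) /\
    (forall e a, ~ D e (act a o)) /\
    (forall e x, ~ D (negb e) x -> D e (s e x)) /\
    (forall e e' a x, D e x -> D e' (act a x) -> e' = e /\ exists c, a = psi e c).
Proof.
  intros Hpsi Hinj.
  destruct (transversal A C (psi true)) as (U & encI & decI & I0 & Im & Ied & Ide); auto.
  destruct (transversal A C (psi false)) as (V & encF & decF & F0 & Fm & Fed & Fde); auto.
  assert (I0' : forall c, decI (psi true c) = (c, None)) by (intros; now rewrite <- I0).
  assert (F0' : forall c, decF (psi false c) = (c, None)) by (intros; now rewrite <- F0).
  assert (Id : forall a c u, decI a = (c, u) -> a = encI c u).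
  { intros a c u E; rewrite <- (Ide a), E; easy. }
  assert (Fd : forall a c u, decF a = (c, u) -> a = encF c u).
  { intros a c u E; rewrite <- (Fde a), E; easy. }
  set (ofwd := fun w => match w with None => hnn_nil | Some w => @hnn_fwd U V w end).
  set (obwd := fun w => match w with None => hnn_nil | Some w => @hnn_bwd U V w end).
  (* Prepending [t]: the head is split as [psi true c] times a representative, and [c] crosses [t]
     to become [psi false c]. If the representative is trivial and the word starts with the inverse
     letter, the two letters cancel. *)
  set (sf := fun x : A * hnn_word U V => let (a, k) := x in let (c, u) := decI a in
    match k with
    | hnn_nil => (psi false c, hnn_fwd (fwd_fwd u None))
    | hnn_fwd w => (psi false c, hnn_fwd (fwd_fwd u (Some w)))
    | hnn_bwd w =>
      match u with
      | Some u => (psi false c, hnn_fwd (fwd_bwd u w))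
      | None =>
        match w with
        | bwd_bwd v w => (encF c v, obwd w)
        | bwd_fwd v w => (encF c (Some v), hnn_fwd w)
        end
      end
    end).
  set (sb := fun x : A * hnn_word U V => let (a, k) := x in let (c, v) := decF a in
    match k with
    | hnn_nil => (psi true c, hnn_bwd (bwd_bwd v None))
    | hnn_bwd w => (psi true c, hnn_bwd (bwd_bwd v (Some w)))
    | hnn_fwd w =>
      match v with
      | Some v => (psi true c, hnn_bwd (bwd_fwd v w))
      | None =>
        match w with
        | fwd_fwd u w => (encI c u, ofwd w)
        | fwd_bwd u w => (encI c (Some u), hnn_bwd w)
        end
      end
    end).
  exists (A * hnn_word U V)%type, (fun a x => (a * fst x, snd x)),
    (fun e : bool => if e then sb else sf), (1, hnn_nil),
    (fun e x => if e : bool then exists c w, x = (psi true c, hnn_bwd w)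
                else exists c w, x = (psi false c, hnn_fwd w)).
  repeat split.
  - intros [a k]; cbn; grp.
  - intros a b [a' k]; cbn; grp.
  - intros [|] [a k]; unfold sb, sf; cbn.
    + destruct (decI a) as [c u] eqn:E; apply Id in E; subst a.
      destruct k as [| w | w]; cbn; [now rewrite F0' .. |].
      destruct u as [u|]; [now rewrite F0'|].
      rewrite I0; destruct w as [v [w|] | v w]; cbn; now rewrite Fed.
    + destruct (decF a) as [c u] eqn:E; apply Fd in E; subst a.
      destruct k as [| w | w]; cbn; [now rewrite I0' | | now rewrite I0'].
      destruct u as [u|]; [now rewrite I0'|].
      rewrite F0; destruct w as [v [w|] | v w]; cbn; now rewrite Ied.
  - intros c [a k]; unfold sf; cbn.
    destruct (decI a) as [d u] eqn:E; apply Id in E; subst a.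
    rewrite <- Im, Ied.
    destruct k as [| w | w]; cbn; [now rewrite Hpsi .. |].
    destruct u as [u|]; [cbn; now rewrite Hpsi|].
    destruct w; cbn; now rewrite Fm.
  - intros a b E; injection E; rewrite !gmul_1r; auto.
  - intros [|] a (c & w & E); discriminate E.
  - intros [|] [a k] Hn; unfold sb, sf; cbn in *.
    + destruct (decF a) as [c v] eqn:E; apply Fd in E; subst a.
      destruct k as [| w | w]; eauto.
      destruct v as [v|]; eauto.
      destruct Hn; rewrite F0; eauto.
    + destruct (decI a) as [c u] eqn:E; apply Id in E; subst a.
      destruct k as [| w | w]; eauto.
      destruct u as [u|]; eauto.
      destruct Hn; rewrite I0; eauto.
  - destruct e, e'; auto; destruct H as (c & w & ->), H0 as (d & w' & E); discriminate E.
  - destruct e, e'; destruct H as (c & w & ->), H0 as (d & w' & E); try discriminate E;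
      injection E as E _; exists (d * c^-1); rewrite Hpsi, hom_inv, <- E by auto; grp.
Qed.

(** Reduced words of an amalgam over the nontrivial cosets of [C] in [A] and in [B]; one type for
    each first factor makes the alternation automatic. *)
Inductive left_word (U V : Type) : Type :=
| left_cons (u : U) (w : option (right_word U V))
with right_word (U V : Type) : Type :=
| right_cons (v : V) (w : option (left_word U V)).
Arguments left_cons {U V}.
Arguments right_cons {U V}.

Inductive alt_word (U V : Type) : Type :=
| alt_nil | alt_left (w : left_word U V) | alt_right (w : right_word U V).
Arguments alt_nil {U V}.
Arguments alt_left {U V}.
Arguments alt_right {U V}.

Lemma induced_action (A : Grp) (T J : Type) (to : T -> A * J) (from : A * J -> T) :
  (forall x, from (to x) = x) -> (forall p, to (from p) = p) ->
  is_action (fun a x => from (a * fst (to x), snd (to x))).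
Proof.
  intros Hft Htf; split.
  - intros x; rewrite gmul_1l, <- surjective_pairing; auto.
  - intros a b x; rewrite Htf; cbn; now rewrite gmul_assoc.
Qed.

(** Absorbing a leading [A]-letter into the head identifies the normal forms with [A] times a set of
    tails, and likewise for [B]. Each factor acts by multiplication in its own reading; [D] holds
    the words starting with a [B]-letter. *)
Lemma amalgam_action (A B C : Grp) (iA : C -> A) (iB : C -> B) :
  is_hom iA -> injective iA -> is_hom iB -> injective iB ->
  exists (T : Type) (actA : A -> T -> T) (actB : B -> T -> T) (o : T) (D : T -> Prop),
    is_action actA /\ is_action actB /\
    (forall c x, actA (iA c) x = actB (iB c) x) /\
    (forall a b, actA a o = actA b o -> a = b) /\
    (forall a, ~ D (actA a o)) /\
    (forall b x, ~ (exists c, b = iB c) -> ~ D x -> D (actB b x)) /\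
    (forall a x, D x -> D (actA a x) -> exists c, a = iA c).
Proof.
  intros HiA HiAi HiB HiBi.
  destruct (transversal A C iA) as (U & encA & decA & A0 & Am & Aed & Ade); auto.
  destruct (transversal B C iB) as (V & encB & decB & B0 & Bm & Bed & Bde); auto.
  assert (A0' : forall c, decA (iA c) = (c, None)) by (intros; now rewrite <- A0).
  assert (B0' : forall c, decB (iB c) = (c, None)) by (intros; now rewrite <- B0).
  assert (Ad : forall a c u, decA a = (c, u) -> a = encA c u).
  { intros a c u E; rewrite <- (Ade a), E; easy. }
  assert (Bd : forall a c u, decB a = (c, u) -> a = encB c u).
  { intros a c u E; rewrite <- (Bde a), E; easy. }
  set (toA := fun x : C * alt_word U V => match x with
    | (c, alt_nil) => (iA c, None)
    | (c, alt_right w) => (iA c, Some w)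
    | (c, alt_left (left_cons u w)) => (encA c (Some u), w)
    end).
  set (toB := fun x : C * alt_word U V => match x with
    | (c, alt_nil) => (iB c, None)
    | (c, alt_left w) => (iB c, Some w)
    | (c, alt_right (right_cons u w)) => (encB c (Some u), w)
    end).
  set (fromA := fun p : A * option (right_word U V) => let (a, w) := p in
    match decA a with
    | (c, Some u) => (c, alt_left (left_cons u w))
    | (c, None) => (c, match w with None => alt_nil | Some w => alt_right w end)
    end).
  set (fromB := fun p : B * option (left_word U V) => let (b, w) := p in
    match decB b with
    | (c, Some u) => (c, alt_right (right_cons u w))
    | (c, None) => (c, match w with None => alt_nil | Some w => alt_left w end)
    end).
  assert (ftA : forall x, fromA (toA x) = x).
  { intros [c [| [u w] | w]]; cbn; [now rewrite A0' | now rewrite Aed | now rewrite A0']. }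
  assert (ftB : forall x, fromB (toB x) = x).
  { intros [c [| w | [u w]]]; cbn; [now rewrite B0' | now rewrite B0' | now rewrite Bed]. }
  assert (tfA : forall p, toA (fromA p) = p).
  { intros [a w]; cbn; destruct (decA a) as [c [u|]] eqn:E; apply Ad in E; subst a; auto.
    rewrite A0; now destruct w. }
  assert (tfB : forall p, toB (fromB p) = p).
  { intros [a w]; cbn; destruct (decB a) as [c [u|]] eqn:E; apply Bd in E; subst a; auto.
    rewrite B0; now destruct w. }
  exists (C * alt_word U V)%type, (fun a x => fromA (a * fst (toA x), snd (toA x))),
    (fun b x => fromB (b * fst (toB x), snd (toB x))), (1, alt_nil),
    (fun x => exists c w, x = (c, alt_right w)).
  split; [now apply induced_action | split; [now apply induced_action|]].
  repeat split.
  - assert (HA : forall c d k,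
               fromA (iA c * fst (toA (d, k)), snd (toA (d, k))) = (c * d, k)).
    { intros c d [| [u w] | w]; cbn.
      - now rewrite <- HiA, A0'.
      - now rewrite <- Am, Aed.
      - now rewrite <- HiA, A0'. }
    intros c [d k]; rewrite HA; symmetry.
    destruct k as [| w | [u w]]; cbn.
    + now rewrite <- HiB, B0'.
    + now rewrite <- HiB, B0'.
    + now rewrite <- Bm, Bed.
  - intros a b E; apply (f_equal toA) in E; rewrite !tfA in E; cbn in E.
    injection E; rewrite hom_one, !gmul_1r; auto.
  - intros a (c & w & E); cbn in E.
    destruct (decA (a * iA 1)) as [d [u|]]; discriminate E.
  - intros b x Hb Hx.
    (* Off [D] there is no [B]-letter to absorb, so the head lies in [C]. *)
    assert (H : exists d w, toB x = (iB d, w)).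
    { destruct x as [c [| w | w]]; cbn; eauto; destruct Hx; eauto. }
    destruct H as (d & w & ->); cbn.
    destruct (decB (b * iB d)) as [c [u|]] eqn:E; eauto.
    destruct Hb; apply Bd in E; rewrite B0 in E.
    exists (c * d^-1); rewrite HiB, hom_inv, <- E by auto; grp.
  - intros a x (c & w & ->) (d & w' & E); cbn in E.
    destruct (decA (a * iA c)) as [c' [u|]] eqn:E'; [discriminate E|].
    apply Ad in E'; rewrite A0 in E'.
    exists (c' * c^-1); rewrite HiA, hom_inv, <- E' by auto; grp.
Qed.

(** * HNN extensions *)

(* [hnn_branch psi j s true] and [hnn_branch psi j s false] consist of the elements whose
   reduced form starts with [s true] (the inverse of the stable letter) and with [s false]. *)
Inductive hnn_branch {A C G : Grp} (psi : bool -> C -> A) (j : A -> G) (s : bool -> G)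
  : bool -> G -> Prop :=
| hnn_branch_base e a : hnn_branch psi j s e (s e * j a)
| hnn_branch_step e e' a z :
    (e' = negb e -> ~ exists c, a = psi (negb e) c) ->
    hnn_branch psi j s e' z -> hnn_branch psi j s e (s e * (j a * z)).

Lemma HNN_Hucha (A C G : Grp) (i phi : C -> A) (j : A -> G) (t : G) (XA : list A) :
  is_hom i -> injective i -> is_hom phi -> injective phi ->
  is_HNN A C i phi G j t -> left_orderable G -> generates XA -> Prieto C ->
  (forall P, positive_cone A P -> forall r, 0 < r ->
     exists S, negative_swamp XA P (fun a => exists c, i c = a) r S) ->
  (exists a, forall c, a <> i c) -> (exists a, ~ exists c, a = phi c) ->
  Hucha G.
Proof.
  intros Hi Hii Hphi Hphii HG HO HXA HC Hswamp Hproper [x0 Hx0].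
  pose proof (HNN_generates A C G i phi j t XA HG HXA) as HX.
  destruct HG as (Hj & Ht & Hu).
  set (psi := fun e : bool => if e then i else phi).
  assert (Hpsi : forall e, is_hom (psi e)) by now intros [|].
  assert (Hpsii : forall e, injective (psi e)) by now intros [|].
  destruct (HNN_action A C psi Hpsi Hpsii)
    as (T & act & sT & o & R & Hact & HsT & Hrel & Hfree & Ro & Rs & Rdisj).
  destruct (action_hom A T act Hact) as (f & Hf & Hfact).
  set (tT := {| pfun := sT false; pinv := sT true;
                pfunK := HsT true; pinvK := HsT false |} : perm_grp T).
  destruct (Hu (perm_grp T) f tT Hf) as (h & (Hh & Hhj & Hht) & _).
  { intros c; assert (E : tT * f (i c) = f (phi c) * tT).
    { apply perm_ext; intros x; cbn; rewrite !Hfact; apply (Hrel c). }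
    rewrite E; grp. }
  set (s := fun e : bool => if e then t^-1 else t).
  set (D := hnn_branch psi j s).
  assert (sV : forall e, s (negb e) = (s e)^-1) by (intros [|]; cbn; grp).
  assert (s_psi : forall e c, s e * j (psi (negb e) c) = j (psi e c) * s e).
  { intros [|] c; cbn; rewrite <- (Ht c); grp. }
  assert (hs : forall e x, pfun (h (s e) : perm T) x = sT e x).
  { intros [|] x; cbn; [rewrite hom_inv by auto |]; now rewrite Hht. }
  assert (hm : forall x y z, pfun (h (x * y) : perm T) z
                 = pfun (h x : perm T) (pfun (h y : perm T) z)).
  { intros x y z; now rewrite Hh. }
  assert (hj : forall a x, pfun (h (j a) : perm T) x = act a x).
  { intros a x; rewrite Hhj; apply Hfact. }
  (* Ping-pong: branches are told apart by where they send the base point. *)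
  assert (DR : forall e z, D e z -> R e (pfun (h z : perm T) o)).
  { intros e z H; induction H as [e a | e e' a z Ha H IH].
    - rewrite hm, hs, hj; apply Rs, Ro.
    - rewrite !hm, hs, hj; apply Rs; intros HR.
      destruct (Rdisj _ _ _ _ IH HR) as [E [c Hc]].
      apply Ha; auto; exists c; now rewrite E. }
  assert (D_letter : forall e, D e (s e)).
  { intros e; rewrite <- (gmul_1r _ (s e)); rewrite <- (hom_one _ _ j Hj).
    apply hnn_branch_base. }
  assert (D_psi : forall e c z, D e z -> D e (j (psi e c) * z)).
  { intros e c z H; destruct H as [e a | e e' a z Ha H];
      rewrite gmul_assoc, <- s_psi, <- gmul_assoc.
    - rewrite <- Hj; apply hnn_branch_base.
    - rewrite (gmul_assoc _ (j _) (j a)), <- Hj; apply (hnn_branch_step _ _ _ e e'); auto.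
      intros E (d & Hd); apply (Ha E), (image_mul_l A C _ c); eauto. }
  assert (D_right : forall e z a, D e z -> D e (z * j a)).
  { intros e z a H; induction H as [e b | e e' b z Hb H IH]; rewrite <- gmul_assoc.
    - rewrite <- Hj; apply hnn_branch_base.
    - rewrite <- gmul_assoc; now apply (hnn_branch_step _ _ _ e e'). }
  (* A new stable letter can cancel only the last one; the branch is left only when that was also
     the first. *)
  assert (D_stable : forall e e' z, D e z -> D e (z * s e') \/ exists c, z * s e' = j (psi e c)).
  { intros e e' z H; induction H as [e a | e e'' a z Ha H [IH | [c IH]]].
    - destruct (classic (e' = negb e /\ exists c, a = psi (negb e) c)) as [[-> [c ->]] | Hn].
      + right; exists c; rewrite s_psi, sV; grp.
      + left; rewrite <- gmul_assoc; apply (hnn_branch_step _ _ _ e e'); [tauto | apply D_letter].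
    - left; rewrite <- !gmul_assoc; now apply (hnn_branch_step _ _ _ e e'').
    - left; rewrite <- !gmul_assoc, IH, <- Hj; apply hnn_branch_base. }
  assert (X_letter : forall x, letter (t :: map j XA) x ->
             (exists a, x = j a) \/ exists e, x = s e).
  { intros x [[<- | Hx] | [Hx | Hx]].
    - right; now exists false.
    - apply in_map_iff in Hx; destruct Hx as (a & <- & _); eauto.
    - right; exists true; cbn; rewrite Hx; grp.
    - apply in_map_iff in Hx; destruct Hx as (a & Ha & _); left; exists (a^-1).
      rewrite hom_inv, Ha by auto; grp. }
  assert (D_step : forall e z x, D e z -> letter (t :: map j XA) x ->
             D e (z * x) \/ exists c, z * x = j (psi e c)).
  { intros e z x Hz Hx; destruct (X_letter x Hx) as [[a ->] | [e' ->]]; auto. }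
  assert (cover : forall g, exists a z, g = j a * z /\ (z = 1 \/ exists e, D e z)).
  { apply (generates_ind G _ _ HX).
    - exists 1, 1; rewrite (hom_one _ _ j Hj); grp.
    - intros g x Hx (a & z & -> & [-> | [e He]]).
      + destruct (X_letter x Hx) as [[b ->] | [e ->]].
        * exists (a * b), 1; rewrite Hj; grp.
        * exists a, (s e); grp; eauto.
      + destruct (D_step e z x He Hx) as [H | [c H]].
        * exists a, (z * x); grp; eauto.
        * exists (a * psi e c), 1; rewrite <- gmul_assoc, H, Hj; grp. }
  apply (Hucha_of_branches A C G j psi D XA (t :: map j XA)); auto.
  - intros a b E; apply Hfree; rewrite <- !hj; now rewrite E.
  - intros e a H; apply DR in H; rewrite hj in H; now apply Ro in H.
  - intros e a z H H'; apply DR in H, H'; rewrite hm, hj in H'.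
    apply (Rdisj _ _ _ _ H H').
  - intros x Hx; destruct (X_letter x Hx) as [Ha | [e ->]]; eauto.
  (* This is [t^-1 * j x0 * t] with [x0] outside [phi C]. No cancellation occurs in [t * d] for [d]
     outside the branch, nor afterwards with [x0] or [x0^-1]. *)
  - exists (s true * (j x0 * s false)); intros d Hd.
    assert (D_false : D false (s false * d)).
    { destruct (cover d) as (a & z & -> & [-> | [e He]]).
      - rewrite gmul_1r; apply hnn_branch_base.
      - apply (hnn_branch_step _ _ _ false e); auto.
        intros -> [c ->]; apply Hd; now apply D_psi. }
    assert (Hs : s false = (s true)^-1) by apply (sV true).
    split.
    + rewrite <- !gmul_assoc; apply (hnn_branch_step _ _ _ true false); auto.
    + replace ((s true * (j x0 * s false))^-1 * d) with (s true * (j (x0^-1) * (s false * d)))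
        by (rewrite Hs, hom_inv by auto; grp).
      apply (hnn_branch_step _ _ _ true false); auto.
      intros _ H; now apply Hx0, (image_inv A C phi).
Qed.

(** * Amalgamated products *)

(* The elements whose reduced form starts with a letter of [B] outside [C]. *)
Inductive amalgam_branch {A B C G : Grp} (iA : C -> A) (iB : C -> B)
    (jA : A -> G) (jB : B -> G) : G -> Prop :=
| amalgam_branch_base b a : (~ exists c, b = iB c) ->
    amalgam_branch iA iB jA jB (jB b * jA a)
| amalgam_branch_step b a z : (~ exists c, b = iB c) -> (~ exists c, a = iA c) ->
    amalgam_branch iA iB jA jB z -> amalgam_branch iA iB jA jB (jB b * (jA a * z)).

Lemma amalgam_acts (A B C G : Grp) (iA : C -> A) (iB : C -> B)
    (jA : A -> G) (jB : B -> G) :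
  is_hom iA -> injective iA -> is_hom iB -> injective iB ->
  is_amalgam A B C iA iB G jA jB ->
  exists (T : Type) (act : A -> T -> T) (f : G -> perm_grp T) (o : T) (R : T -> Prop),
    is_hom f /\ (forall a x, pfun (f (jA a) : perm T) x = act a x) /\
    (forall a b, act a o = act b o -> a = b) /\
    (forall a, ~ R (act a o)) /\
    (forall b x, ~ (exists c, b = iB c) -> ~ R x -> R (pfun (f (jB b) : perm T) x)) /\
    (forall a x, R x -> R (act a x) -> exists c, a = iA c).
Proof.
  intros HiA HiAi HiB HiBi (HjA & HjB & Hc & Hu).
  destruct (amalgam_action A B C iA iB)
    as (T & actA & actB & o & R & HactA & HactB & Hrel & Hfree & Ro & RB & RA); auto.
  destruct (action_hom A T actA HactA) as (fA & HfA & HfactA).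
  destruct (action_hom B T actB HactB) as (fB & HfB & HfactB).
  destruct (Hu (perm_grp T) fA fB HfA HfB) as (h & (Hh & HhA & HhB) & _).
  { intros c; apply perm_ext; intros x; now rewrite HfactA, HfactB. }
  exists T, actA, h, o, R; repeat split; auto.
  - intros a x; now rewrite HhA.
  - intros b x; rewrite HhB, HfactB; auto.
Qed.

Lemma amalgam_Hucha_proper (A B C G : Grp) (iA : C -> A) (iB : C -> B)
    (jA : A -> G) (jB : B -> G) (XA : list A) (XB : list B) :
  is_hom iA -> injective iA -> is_hom iB -> injective iB ->
  is_amalgam A B C iA iB G jA jB -> left_orderable G ->
  generates XA -> generates XB -> Prieto C ->
  (forall P, positive_cone A P -> forall r, 0 < r ->
     exists S, negative_swamp XA P (fun a => exists c, iA c = a) r S) ->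
  (exists a, forall c, a <> iA c) -> (exists b, ~ exists c, b = iB c) ->
  Hucha G.
Proof.
  intros HiA HiAi HiB HiBi HG HO HXA HXB HC Hswamp Hproper [y0 Hy0].
  pose proof (amalgam_generates A B C G iA iB jA jB XA XB HG HXA HXB) as HX.
  destruct (amalgam_acts A B C G iA iB jA jB)
    as (T & act & h & o & R & Hh & hA & Hfree & Ro & RB & RA); auto.
  destruct HG as (HjA & HjB & Hc & _).
  set (X := map jA XA ++ map jB XB) in *.
  set (D := amalgam_branch iA iB jA jB).
  assert (hm : forall x y z, pfun (h (x * y) : perm T) z
                 = pfun (h x : perm T) (pfun (h y : perm T) z)).
  { intros x y z; now rewrite Hh. }
  assert (DR : forall z, D z -> R (pfun (h z : perm T) o)).
  { intros z H; induction H as [b a Hb | b a z Hb Ha H IH].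
    - rewrite hm, hA; auto.
    - rewrite !hm, hA; apply RB; auto; intros HR; apply Ha, (RA a _ IH HR). }
  assert (D_letter : forall b, (~ exists c, b = iB c) -> D (jB b)).
  { intros b Hb; rewrite <- (gmul_1r _ (jB b)), <- (hom_one _ _ jA HjA).
    now apply amalgam_branch_base. }
  assert (B_mul_r : forall b c, (~ exists d, b = iB d) -> ~ exists d, b * iB c = iB d).
  { intros b c Hb [d Hd]; apply Hb; exists (d * c^-1).
    rewrite HiB, hom_inv, <- Hd by auto; grp. }
  assert (D_iA : forall c z, D z -> D (jA (iA c) * z)).
  { intros c z H; destruct H as [b a Hb | b a z Hb Ha H];
      rewrite Hc, gmul_assoc, <- HjB;
      [apply amalgam_branch_base | apply amalgam_branch_step]; auto;
      intros Hd; apply Hb, (image_mul_l B C iB c); auto. }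
  assert (D_right : forall z a, D z -> D (z * jA a)).
  { intros z a H; induction H as [b a' Hb | b a' z Hb Ha H IH]; rewrite <- !gmul_assoc.
    - rewrite <- HjA; now apply amalgam_branch_base.
    - now apply amalgam_branch_step. }
  (* If the last [A]-letter lies in [C], the neighbouring [B]-letters merge, and only their product
     can fall into [C]. *)
  assert (D_B : forall z b, D z -> D (z * jB b) \/ exists c, z * jB b = jA (iA c)).
  { intros z y H; induction H as [b a Hb | b a z Hb Ha H [IH | [c IH]]].
    - destruct (classic (exists c, a = iA c)) as [[c ->] | Ha].
      + rewrite Hc, <- !HjB.
        destruct (classic (exists d, b * iB c * y = iB d)) as [[d Hd] | Hd].
        * right; exists d; now rewrite Hd, Hc.
        * left; now apply D_letter.
      + left; rewrite <- gmul_assoc.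
        destruct (classic (exists d, y = iB d)) as [[d ->] | Hy].
        * rewrite <- Hc, <- HjA; now apply amalgam_branch_base.
        * apply amalgam_branch_step; auto; now apply D_letter.
    - left; rewrite <- !gmul_assoc; now apply amalgam_branch_step.
    - left; rewrite <- !gmul_assoc, IH, <- HjA; now apply amalgam_branch_base. }
  assert (X_letter : forall x, letter X x -> (exists a, x = jA a) \/ exists b, x = jB b).
  { assert (H : forall x, In x X -> (exists a, x = jA a) \/ exists b, x = jB b).
    { intros x Hx; apply in_app_or in Hx; rewrite !in_map_iff in Hx.
      destruct Hx as [(a & <- & _) | (b & <- & _)]; eauto. }
    intros x [Hx | Hx]; auto.
    destruct (H _ Hx) as [[a Ha] | [b Hb]].
    - left; exists (a^-1); rewrite hom_inv, <- Ha by auto; grp.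
    - right; exists (b^-1); rewrite hom_inv, <- Hb by auto; grp. }
  assert (D_step : forall z x, D z -> letter X x -> D (z * x) \/ exists c, z * x = jA (iA c)).
  { intros z x Hz Hx; destruct (X_letter x Hx) as [[a ->] | [b ->]]; auto. }
  assert (Dout : forall x, letter X x -> (exists a, x = jA a) \/ D x).
  { intros x Hx; destruct (X_letter x Hx) as [Ha | [b ->]]; auto.
    destruct (classic (exists c, b = iB c)) as [[c ->] | Hb]; auto.
    left; exists (iA c); auto. }
  assert (cover : forall g, exists a z, g = jA a * z /\ (z = 1 \/ D z)).
  { apply (generates_ind G _ _ HX).
    - exists 1, 1; rewrite (hom_one _ _ jA HjA); grp.
    - intros g x Hx (a & z & -> & [-> | Hz]).
      + destruct (Dout x Hx) as [[b ->] | Dx].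
        * exists (a * b), 1; rewrite HjA; grp.
        * exists a, x; grp.
      + destruct (D_step z x Hz Hx) as [H | [c H]].
        * exists a, (z * x); grp.
        * exists (a * iA c), 1; rewrite <- gmul_assoc, H, HjA; grp. }
  assert (D_left : forall b d, (~ exists c, b = iB c) -> ~ D d -> D (jB b * d)).
  { intros b d Hb Hd; destruct (cover d) as (a & z & -> & [-> | Hz]).
    - rewrite gmul_1r; now apply amalgam_branch_base.
    - apply amalgam_branch_step; auto; intros [c ->]; apply Hd; auto. }
  (* At the vertex [jA A] all edges are of one kind, so the branch for [false] is empty. *)
  apply (Hucha_of_branches A C G jA (fun _ => iA)
           (fun e z => if e : bool then D z else False) XA X); auto.
  - intros a b E; apply Hfree; rewrite <- !hA; now rewrite E.
  - intros [|] a H; auto; apply DR in H; rewrite hA in H; now apply Ro in H.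
  - intros [|] a z H H'; [| easy]; split; auto.
    apply DR in H, H'; rewrite hm, hA in H'; apply (RA _ _ H H').
  - intros x Hx; destruct (Dout x Hx) as [Ha | Hx']; auto; right; now exists true.
  - intros [|] z x Hz Hx; [auto | easy].
  - exists (jB y0); intros d Hd; split; auto.
    rewrite <- hom_inv by auto; apply D_left; auto.
    intros H; now apply Hy0, (image_inv B C iB).
Qed.

(** * The degenerate amalgam, properness of the edge groups, and the conclusion *)

Lemma rpath_map_inv (A G : Grp) (j : A -> G) (X : list A) (r : nat) (a : A) (l : list G) :
  is_hom j -> injective j -> rpath (map j X) r (j a) l ->
  exists l', l = map j l' /\ rpath X r a l'.
Proof.
  intros Hj Hji.
  assert (Hw : forall w, Forall (letter (map j X)) w ->
             exists w', Forall (letter X) w' /\ length w' = length w /\ j (wprod w') = wprod w).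
  { induction 1 as [| s w Hs Hw (w' & Hw' & Hlen & E)];
      [exists []; repeat split; auto; now apply hom_one|].
    assert (exists b, letter X b /\ j b = s) as (b & Hb & <-).
    { destruct Hs as [Hs | Hs]; apply in_map_iff in Hs; destruct Hs as (b & Hb & HbX).
      - exists b; split; auto; now left.
      - exists (b^-1); split; [right; now rewrite ginv_inv|].
        rewrite hom_inv, Hb by auto; grp. }
    exists (b :: w'); rewrite !wprod_cons, Hj, E; cbn; rewrite Hlen; auto. }
  revert a; induction l as [| g l IH]; intros a Hl; [now exists []|].
  destruct Hl as [(w & Hlen & HwX & <-) Hl].
  destruct (Hw w HwX) as (w' & Hw' & Hlen' & E).
  rewrite <- E, <- Hj in Hl |- *.
  destruct (IH _ Hl) as (l' & -> & Hl').
  exists (a * wprod w' :: l'); repeat split; auto.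
  exists w'; rewrite Hlen'; auto.
Qed.

Lemma last_map (S T : Type) (f : S -> T) (l : list S) (x : S) :
  last (map f l) (f x) = f (last l x).
Proof.
  revert x; induction l as [| y l IH]; intros x; [easy|].
  cbn [map]; now rewrite !last_cons_default.
Qed.

Lemma separated_of_swamp (A : Grp) (X : list A) (P H S : A -> Prop) (r : nat) :
  positive_cone A P -> negative_swamp X P H r S ->
  exists u v, P u /\ P v /\ forall r', r' <= r -> ~ linked X r' (nonneg P) u v.
Proof.
  intros HP (HS & (u & v & Hu & Hv & Hd) & _); exists u, v; repeat split; auto.
  intros r' Hr'; apply (disconnects_not_linked A X r r' P S _ _ u v HP HS Hd); auto.
  now left.
Qed.

Lemma Hucha_bijection (A G : Grp) (j : A -> G) (X : list A) (H : A -> Prop) :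
  is_hom j -> injective j -> (forall g, exists a, g = j a) -> generates X ->
  left_orderable G ->
  (forall P, positive_cone A P -> forall r, 0 < r -> exists S, negative_swamp X P H r S) ->
  Hucha G.
Proof.
  intros Hj Hji Hsurj HX HG Hswamp.
  apply (Hucha_of_separated G (map j X)); auto.
  - intros g; destruct (Hsurj g) as [a ->].
    apply (span_hom G A j _ X); auto; intros y; apply in_map.
  - intros P HP r.
    assert (HQ : positive_cone A (fun a => P (j a))) by now apply cone_pullback.
    (* The successor, because [r] may be 0 and swamps are given only for positive widths. *)
    destruct (Hswamp _ HQ (Datatypes.S r)) as [S HS]; [lia|].
    destruct (separated_of_swamp A X _ H S _ HQ HS) as (u & v & Hu & Hv & Huv).
    exists (j u), (j v); repeat split; auto; intros l Hl El Nl.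
    destruct (rpath_map_inv A G j X r u l Hj Hji Hl) as (l' & -> & Hl').
    rewrite last_map in El; apply Hji in El; subst v.
    apply (Huv r); [lia|]; apply path_linked; auto; [now left|].
    apply Forall_forall; intros a Ha; rewrite Forall_forall in Nl.
    destruct (Nl (j a) (in_map j l' a Ha)) as [Hn | Hn]; [now left | right].
    apply Hji; now rewrite Hn, hom_one.
Qed.

(** If [phi] were onto, [A] would be one coset of its image, and [coset_linked] would join the two
    positive elements that a wide swamp separates. *)
Lemma Prieto_not_onto (A C : Grp) (phi : C -> A) (X : list A) (H : A -> Prop) :
  is_hom phi -> injective phi -> Prieto C -> generates X -> left_orderable A ->
  (forall P, positive_cone A P -> forall r, 0 < r -> exists S, negative_swamp X P H r S) ->
  exists a, ~ exists c, a = phi c.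
Proof.
  intros Hphi Hinj HC HX [P HP] Hswamp; apply NNPP; intros Hn.
  destruct (coset_linked A C phi X P HC) as [r Hr]; auto.
  destruct (Hswamp P HP (S r)) as [S HS]; [lia|].
  destruct (separated_of_swamp A X P H S _ HP HS) as (u & v & Hu & Hv & Huv).
  apply (Huv r); [lia|].
  destruct (classic (exists c, u^-1 * v = phi c)) as [[c Hc] | Hc]; [| exfalso; eauto].
  replace v with (u * phi c) in * by (rewrite <- Hc; grp).
  apply Hr; now left.
Qed.

(* If [C = A] then the swamp for [C] would have to contain all of [A]. *)
Lemma swamp_proper (A C : Grp) (i : C -> A) (X : list A) :
  left_orderable A ->
  (forall P, positive_cone A P -> forall r, 0 < r ->
     exists S, negative_swamp X P (fun a => exists c, i c = a) r S) ->
  exists a, forall c, a <> i c.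
Proof.
  intros [P HP] Hswamp; apply NNPP; intros Hn.
  destruct (Hswamp P HP 1%nat) as (S & HS & _ & g1 & g2 & Hg); [lia|].
  assert (Hi : forall g a, lcoset g (fun a => exists c, i c = a) a).
  { intros g a; exists (g^-1 * a); split; [| grp].
    apply NNPP; intros Ha; apply Hn; exists (g^-1 * a); intros c Hc; eauto. }
  (* The one-point path at 1 already joins the two cosets, which forces 1 to be negative. *)
  destruct (Hg 1 [] (Hi _ _) (Hi _ _) I) as (y & [-> | []] & Hy).
  apply HS in Hy; destruct HP as (_ & _ & _ & _ & H); auto.
Qed.


Theorem theorem1p6 (A C : Grp) (i : C -> A) :
  is_hom i -> injective i ->
  fin_gen A -> left_orderable A ->
  Hucha_wrt A (image_sub i) ->
  Prieto C ->
  (forall phi : C -> A, is_hom phi -> injective phi ->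
     forall (G : Grp) (j : A -> G) (t : G),
       is_HNN A C i phi G j t -> left_orderable G -> Hucha G) /\
  (forall (B : Grp) (k : C -> B), is_hom k -> injective k -> fin_gen B ->
     forall (G : Grp) (jA : A -> G) (jB : B -> G),
       is_amalgam A B C i k G jA jB -> left_orderable G -> Hucha G).

Proof.
  intros Hi Hii HA HAo (_ & X & HX & HH) HC.
  assert (Hswamp : forall P, positive_cone A P -> forall r, 0 < r ->
            exists S, negative_swamp X P (fun a => exists c, i c = a) r S).
  { intros P HP r Hr; apply HH; auto; easy. }
  pose proof (swamp_proper A C i X HAo Hswamp) as Hproper.
  split.
  - intros phi Hphi Hphii G j t HG HO.
    apply (HNN_Hucha A C G i phi j t X); auto.
    apply (Prieto_not_onto A C phi X _ Hphi Hphii HC HX HAo Hswamp).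
  - intros B k Hk Hki [XB HXB] G jA jB HG HO.
    destruct (classic (exists b, ~ exists c, b = k c)) as [Hb | Hb].
    + apply (amalgam_Hucha_proper A B C G i k jA jB X XB); auto.
    (* When [k] is onto, [jA] is bijective: injective by freeness at the base point, onto because
       the letters from [B] come from [C]. *)
    + pose proof (amalgam_generates A B C G i k jA jB X XB HG HX HXB) as HXG.
      destruct (amalgam_acts A B C G i k jA jB)
        as (T & act & h & o & R & Hh & hA & Hfree & _); auto.
      destruct HG as (HjA & HjB & Hc & _).
      assert (Hinj : injective jA).
      { intros a b E; apply Hfree; rewrite <- !hA; now rewrite E. }
      apply (Hucha_bijection A G jA X (fun a => exists c, i c = a)); auto.
      assert (Hlet : forall x, In x (map jA X ++ map jB XB) -> exists a, x = jA a).
      { intros x Hx; apply in_app_or in Hx; rewrite !in_map_iff in Hx.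
        destruct Hx as [(a & <- & _) | (b & <- & _)]; eauto.
        destruct (classic (exists c, b = k c)) as [[c ->] | Hn];
          [exists (i c); auto | exfalso; eauto]. }
      apply (generates_ind G _ _ HXG).
      * exists 1; now rewrite hom_one.
      * intros g s Hs [a ->]; destruct Hs as [Hs | Hs]; destruct (Hlet _ Hs) as [b Hb'].
        -- exists (a * b); now rewrite Hb', HjA.
        -- exists (a * b^-1); rewrite HjA, hom_inv, <- Hb' by auto; grp.
Qed.
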